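(* Let $(A^+,\Delta)$ be a monoidal Garside structure such that $A^+$ has a $\nu$-structure. Denote by $A$ the group of fractions of $A^+$, and let $\mathcal{R}^\nu(A)$ be the subgroupoid of the ribbon groupoid $\mathcal{R}(A)$ (with the same objects) generated by the elements $\nu(X,s)$. (i) Let $\mathcal{QZ}(A)$ be the totally disconnected groupoid whose objects are the standard parabolic subgroups of $A$ and whose vertex group at $A_X$ is $QZ(A_X)$. Then $$\mathcal{R}(A)=\mathcal{QZ}(A)\rtimes\mathcal{R}^\nu(A).$$ (ii) Let $\mathrm{Conj}(A)$ be the groupoid whose objects are the standard parabolic subgroups of $A$, whose morphism set from $A_X$ to $A_Y$ is $\{g\in A\mid g^{-1}A_Xg=A_Y\}$, and whose composition is the product in $A$. Let $\mathcal{P}(A)$ be the totally disconnected groupoid whose objects are the standard parabolic subgroups of $A$ and whose vertex group at $A_X$ is $A_X$. Then $$\mathrm{Conj}(A)=\mathcal{P}(A)\rtimes\mathcal{R}^\nu(A).$$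
   Context: Categories are small, composition is written left to right. For a category $\mathcal{C}$, $\mathcal{C}_{x\to\cdot}$ (resp. $\mathcal{C}_{\cdot\to x}$) is the set of morphisms with source (resp. target) $x$. An atom is a non-identity morphism that is not a product of two non-identity morphisms; $v$ left-divides $w$ if $w=vu$, right-divides $w$ if $w=uv$, is a factor of $w$ if $w=w_1vw_2$. A monoidal Garside structure is a pair $(A^+,\Delta)$ where $A^+$ is a monoid that is noetherian (every infinite sequence in which each term is a factor of the previous one is eventually constant) and left and right cancellative, $\Delta\in A^+$, there is an automorphism $\Phi$ of $A^+$ with $\Delta\Phi(v)=v\Delta$ for all $v$, $A^+$ is a lattice for left-divisibility and for right-divisibility, and for each atom $v$ there is $\overline v\in A^+$ with $v\overline v=\Delta=\overline v\,\Phi(v)$. $A^+$ embeds in its group of fractions $A$. Let $S$ be its atom set and $\vee,\wedge$ (resp. $\tilde\vee,\tilde\wedge$) lcm and gcd in $A^+$ for left- (resp. right-) divisibility. A submonoid $P$ of $A^+$ is parabolic if it is a sublattice of $A^+$ both for left- and right-divisibility, and there is $\delta\in A^+$ with $\delta^{-1}P\delta=P$ such that the set of left-divisors of $\delta$ in $A^+$ equals $\{g\in P: g\text{ left-divides }\Delta\}$ and equals $\{\Delta\wedge p:p\in P\}$. Its atoms are the atoms of $A^+$ in $P$. $A_X^+$ denotes a parabolic submonoid with atom set $X\subseteq S$ and $A_X$ the subgroup of $A$ it generates (a standard parabolic subgroup); $A_X\cap A^+=A_X^+$. The quasi-centralizer is $QZ(A_X)=\{g\in A_X: gA_X^+=A_X^+g\}$.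 The positive ribbon category $\mathcal{R}^+(A^+)$ has as objects the parabolic submonoids; morphisms $A_X^+\to A_Y^+$ are the $g\in A^+$ with $g^{-1}A_X^+g=A_Y^+$; composition is the product. The ribbon groupoid $\mathcal{R}(A)$ has as objects the $A_X$; morphisms $A_X\to A_Y$ are the $g\in A$ with $g^{-1}A_X^+g=A_Y^+$; composition is the product. $A^+$ has a $\nu$-structure if for each parabolic submonoid $A_X^+$ there are maps $\nu_X:S\to\mathcal{R}^+(A^+)_{A_X^+\to\cdot}$ and $\tilde\nu_X:S\to\mathcal{R}^+(A^+)_{\cdot\to A_X^+}$ whose values are atoms of $\mathcal{R}^+(A^+)$ and such that: if $s\in S$ left-divides $g\in\mathcal{R}^+(A^+)_{A_X^+\to\cdot}$ then $\nu_X(s)$ left-divides $g$; if $s$ right-divides $g\in\mathcal{R}^+(A^+)_{\cdot\to A_X^+}$ then $\tilde\nu_X(s)$ right-divides $g$; for all $s,t\in S$, $\nu_X(s)\vee\nu_X(t)\in\mathcal{R}^+(A^+)_{A_X^+\to\cdot}$ and $\tilde\nu_X(s)\tilde\vee\tilde\nu_X(t)\in\mathcal{R}^+(A^+)_{\cdot\to A_X^+}$. The element $\nu_X(s)$ is denoted $\nu(X,s)$ when it does not belong to $A_X^+$ (and $\tau(X,s)$ when it does); it is viewed as a morphism of $\mathcal{R}(A)$ with source $A_X$. Semi-direct product: let $\mathcal{D},\mathcal{D}'$ be subcategories of a category $\mathcal{C}$ with $\mathcal{D}$ totally disconnected (the union of its vertex monoids $\mathcal{D}_{x\to x}$). One writes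 $\mathcal{C}=\mathcal{D}\rtimes\mathcal{D}'$ if every morphism $g$ of $\mathcal{C}$ decomposes uniquely as $g=g_1g_2$ with $g_1$ a morphism of $\mathcal{D}$ and $g_2$ a morphism of $\mathcal{D}'$, and $\mathcal{D}_{x\to x}\,g=g\,\mathcal{D}_{y\to y}$ for every $g\in\mathcal{D}'_{x\to y}$. *)

(* Defs.v *)
From HB Require Import structures.
From mathcomp Require Import all_boot.
From mathcomp Require Import boolp classical_sets.

Set Implicit Arguments.
Unset Strict Implicit.
Unset Printing Implicit Defensive.

Import Algebra.

Local Open Scope classical_set_scope.
Local Open Scope group_scope.

Section Divisibility.
Variable M : monoidType.
Implicit Types (le : M -> M -> Prop) (P : set M) (s u v w x y z : M).

Definition ldvd v w : Prop := exists u, w = v * u.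
Definition rdvd v w : Prop := exists u, w = u * v.
Definition factor v w : Prop := exists w1 w2, w = w1 * v * w2.

Definition atom s : Prop :=
  s <> 1 /\ forall v w, s = v * w -> v = 1 \/ w = 1.

Definition noetherian : Prop :=
  forall f : nat -> M, (forall n, factor (f n.+1) (f n)) ->
    exists N, forall n, (N <= n)%N -> f n = f N.

Definition left_cancellative : Prop := forall u v w, u * v = u * w -> v = w.
Definition right_cancellative : Prop := forall u v w, v * u = w * u -> v = w.

(* For [le := ldvd] (resp. [rdvd]), joins and meets are the lcm's and gcd's
   for left- (resp. right-) divisibility. *)
Definition is_join le x y z : Prop :=
  [/\ le x z, le y z & forall w, le x w -> le y w -> le z w].
Definition is_meet le x y z : Prop :=
  [/\ le z x, le z y & forall w, le w x -> le w y -> le w z].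

(* Reflexivity and transitivity are automatic for divisibility relations. *)
Definition is_lattice le : Prop :=
  (forall x y, le x y -> le y x -> x = y) /\
  (forall x y, (exists z, is_join le x y z) /\ (exists z, is_meet le x y z)).

Definition is_submonoid P : Prop :=
  P 1 /\ forall x y, P x -> P y -> P (x * y).

Definition is_sublattice le P : Prop :=
  forall x y z, P x -> P y -> is_join le x y z \/ is_meet le x y z -> P z.

Record garside_structure (Delta : M) : Prop := {
  garside_noetherian : noetherian;
  garside_lcancel : left_cancellative;
  garside_rcancel : right_cancellative;
  garside_lattice_l : is_lattice ldvd;
  garside_lattice_r : is_lattice rdvd;
  garside_automorphism : exists Phi : M -> M,
    [/\ monoid_morphism Phi, bijective Phi,
        forall v, Delta * Phi v = v * Delta
      & forall v, atom v ->
          exists v', v * v' = Delta /\ v' * Phi v = Delta] }.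

End Divisibility.

(* A category with set of objects [Ob] in which a morphism from x to y is an
   element of the monoid T and the composition (from left to right) is the
   product of T: a morphism is a triple (x, g, y) such that [mor x y g]. *)
Record mcat (T : monoidType) (Ob : Type) := MCat {
  mor :> Ob -> Ob -> set T;
  mor_id : forall x, mor x x 1;
  mor_comp : forall x y z g h, mor x y g -> mor y z h -> mor x z (g * h) }.

Section Categories.
Variables (T : monoidType) (Ob : Type).
Implicit Types C D : mcat T Ob.

Definition is_identity (x y : Ob) (g : T) : Prop := x = y /\ g = 1.

Definition cat_atom C (x y : Ob) (g : T) : Prop :=
  [/\ C x y g, ~ is_identity x y g &
      forall z g1 g2, C x z g1 -> C z y g2 -> g = g1 * g2 ->
        is_identity x z g1 \/ is_identity z y g2].

Definition subcategory D C : Prop := forall x y, D x y `<=` C x y.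

Definition totally_disconnected D : Prop := forall x y g, D x y g -> x = y.

(* C = D ><| D'. Only subcategories with the same objects as C have to be
   considered, as each identity of C has to decompose. *)
Definition semidirect C D D' : Prop :=
  [/\ subcategory D C, subcategory D' C, totally_disconnected D,
      forall x y g, C x y g ->
        exists! d : Ob * (T * T),
          [/\ D x d.1 d.2.1, D' d.1 y d.2.2 & g = d.2.1 * d.2.2]
    & forall x y g, D' x y g ->
        [set h * g | h in D x x] = [set g * h | h in D y y]].

Section Disconnected.
Variable V : Ob -> set T.
Hypothesis V1 : forall x, V x 1.
Hypothesis VM : forall x g h, V x g -> V x h -> V x (g * h).

Definition disconnected_mor (x y : Ob) : set T := [set g | x = y /\ V x g].

Fact disconnected_id x : disconnected_mor x x 1.
Proof. by split. Qed.

Fact disconnected_comp x y z g h : disconnected_mor x y g ->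
  disconnected_mor y z h -> disconnected_mor x z (g * h).
Proof. by move=> [<- Vg] [<- Vh]; split=> //; apply: VM. Qed.

Definition disconnected : mcat T Ob := MCat disconnected_id disconnected_comp.
End Disconnected.

End Categories.

Section Groupoids.
Variables (A : groupType) (Ob : Type).
Implicit Types C D : mcat A Ob.

Definition inverse_closed D : Prop :=
  forall x y g, D x y g -> D y x g^-1.

Section Generated.
Variables (C : mcat A Ob) (G : Ob -> Ob -> set A).

Definition generated_mor (x y : Ob) : set A :=
  [set g | forall D, subcategory D C -> inverse_closed D ->
     (forall x' y', G x' y' `<=` D x' y') -> D x y g].

Fact generated_id x : generated_mor x x 1.
Proof. by move=> D _ _ _; apply: mor_id. Qed.

Fact generated_comp x y z g h :
  generated_mor x y g -> generated_mor y z h -> generated_mor x z (g * h).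
Proof.
by move=> gg gh D DC DV GD; apply: mor_comp (gg D DC DV GD) (gh D DC DV GD).
Qed.

(* The smallest subgroupoid of C with the same objects that contains G. *)
Definition generated_subgroupoid : mcat A Ob :=
  MCat generated_id generated_comp.
End Generated.

Definition is_subgroup (H : set A) : Prop :=
  H 1 /\ forall x y, H x -> H y -> H (x * y^-1).

Definition conj_set (H : set A) (g : A) : set A := [set x ^ g | x in H].

Lemma conj_set1 H : conj_set H 1 = H.
Proof.
apply/seteqP; split=> [_ [x Hx <-]|x Hx]; first by rewrite conjg1.
by exists x => //; rewrite conjg1.
Qed.

Lemma conj_setM H g h : conj_set H (g * h) = conj_set (conj_set H g) h.
Proof.
apply/seteqP; split=> [_ [x Hx <-]|_ [_ [x Hx <-] <-]].
  by exists (x ^ g); [exists x | rewrite conjgM].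
by exists x => //; rewrite conjgM.
Qed.

End Groupoids.

Section Garside.
Variables (M : monoidType) (A : groupType) (iota : UMagmaMorphism.type M A).

Definition group_of_fractions : Prop :=
  injective iota /\ forall g, exists a b, g = iota a * (iota b)^-1.

Variable Delta : M.
Implicit Types (P Q : set M).

Definition parabolic P : Prop :=
  [/\ is_submonoid P, is_sublattice (@ldvd M) P, is_sublattice (@rdvd M) P
    & exists delta : M,
      [/\ conj_set (iota @` P) (iota delta) = iota @` P,
          [set g | ldvd g delta] = [set g | P g /\ ldvd g Delta]
        & [set g | ldvd g delta] =
          [set g | exists2 p, P p & is_meet (@ldvd M) Delta p g]]].

(* An object X stands both for the parabolic submonoid A_X^+ and for the
   standard parabolic subgroup A_X = [pargroup X]; the two determine each
   other, since A_X^+ is the intersection of A_X and A^+. *)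
Record par := Par { pos : set M; par_parabolic : parabolic pos }.
Implicit Types X Y Z : par.

(* A_X^+, viewed in A *)
Definition parmonoid X : set A := iota @` pos X.
Definition pargroup X : set A := smallest (@is_subgroup A) (parmonoid X).

Definition ribbon_mor X Y : set A :=
  [set g | conj_set (parmonoid X) g = parmonoid Y].

Fact ribbon_id X : ribbon_mor X X 1.
Proof. exact: conj_set1. Qed.

Fact ribbon_comp X Y Z g h :
  ribbon_mor X Y g -> ribbon_mor Y Z h -> ribbon_mor X Z (g * h).
Proof. by rewrite /ribbon_mor /= conj_setM => -> ->. Qed.

Definition ribbon : mcat A par := MCat ribbon_id ribbon_comp.

Definition pribbon_mor X Y : set M := [set g | ribbon_mor X Y (iota g)].

Fact pribbon_id X : pribbon_mor X X 1.
Proof. by rewrite /pribbon_mor /= gmulf1; apply: ribbon_id. Qed.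

Fact pribbon_comp X Y Z g h :
  pribbon_mor X Y g -> pribbon_mor Y Z h -> pribbon_mor X Z (g * h).
Proof. by rewrite /pribbon_mor /= gmulfM; apply: ribbon_comp. Qed.

Definition pribbon : mcat M par := MCat pribbon_id pribbon_comp.

Definition conj_mor X Y : set A :=
  [set g | conj_set (pargroup X) g = pargroup Y].

Fact conj_id X : conj_mor X X 1.
Proof. exact: conj_set1. Qed.

Fact conj_comp X Y Z g h :
  conj_mor X Y g -> conj_mor Y Z h -> conj_mor X Z (g * h).
Proof. by rewrite /conj_mor /= conj_setM => -> ->. Qed.

Definition conj_groupoid : mcat A par := MCat conj_id conj_comp.

Fact pargroup1 X : pargroup X 1.
Proof. by move=> H [[H1 _] _]. Qed.

Fact pargroupM X g h : pargroup X g -> pargroup X h -> pargroup X (g * h).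
Proof.
move=> Xg Xh H HP; have [[H1 HF] _] := HP.
by rewrite -[h]invgK -[h^-1]mul1g; apply: (HF _ _ (Xg H HP) (HF _ _ H1 (Xh H HP))).
Qed.

Definition parabolic_groupoid : mcat A par := disconnected pargroup1 pargroupM.

Definition qz X : set A :=
  [set g | pargroup X g /\
     [set g * x | x in parmonoid X] = [set x * g | x in parmonoid X]].

Fact qz1 X : qz X 1.
Proof.
split; first exact: pargroup1.
by apply/seteqP; split=> _ [x Xx <-]; exists x => //; rewrite mul1g mulg1.
Qed.

Fact qzM X g h : qz X g -> qz X h -> qz X (g * h).
Proof.
move=> [Xg Eg] [Xh Eh]; split; first exact: pargroupM.
apply/seteqP; split=> _ [x Xx <-].
  have [y Xy Ey] : [set x * h | x in parmonoid X] (h * x).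
    by rewrite -Eh; exists x.
  have [z Xz Ez] : [set x * g | x in parmonoid X] (g * y).
    by rewrite -Eg; exists y.
  by exists z => //; rewrite mulgA Ez -mulgA Ey mulgA.
have [y Xy Ey] : [set g * x | x in parmonoid X] (x * g).
  by rewrite Eg; exists x.
have [z Xz Ez] : [set h * x | x in parmonoid X] (y * h).
  by rewrite Eh; exists y.
by exists z => //; rewrite -mulgA Ez mulgA Ey mulgA.
Qed.

Definition qz_groupoid : mcat A par := disconnected qz1 qzM.

Definition atoms : Type := {s : M | atom s}.

(* The target (resp. source) of a morphism of [pribbon] is determined by its
   source (resp. target) and its label, so that nu and nu' only record labels. *)
Record nu_structure (nu nu' : par -> atoms -> M) : Prop := {
  nu_atom : forall X s, exists Y, cat_atom pribbon X Y (nu X s);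
  nu'_atom : forall X s, exists Y, cat_atom pribbon Y X (nu' X s);
  nu_ldvd : forall X Y (s : atoms) g,
    pribbon X Y g -> ldvd (sval s) g -> ldvd (nu X s) g;
  nu'_rdvd : forall X Y (s : atoms) g,
    pribbon Y X g -> rdvd (sval s) g -> rdvd (nu' X s) g;
  nu_join : forall X s t g,
    is_join (@ldvd M) (nu X s) (nu X t) g -> exists Y, pribbon X Y g;
  nu'_join : forall X s t g,
    is_join (@rdvd M) (nu' X s) (nu' X t) g -> exists Y, pribbon Y X g }.

(* The elements nu(X, s), that is the values of nu_X outside A_X^+, as
   morphisms of the ribbon groupoid. *)
Definition nu_mor (nu : par -> atoms -> M) X Y : set A :=
  [set g | exists s,
     [/\ ~ pos X (nu X s), pribbon X Y (nu X s) & g = iota (nu X s)]].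

Definition nu_groupoid (nu : par -> atoms -> M) : mcat A par :=
  generated_subgroupoid ribbon (nu_mor nu).

End Garside.

Arguments ribbon {M A} iota Delta.
Arguments conj_groupoid {M A} iota Delta.
Arguments parabolic_groupoid {M A} iota Delta.
Arguments qz_groupoid {M A} iota Delta.

(* Main.v *)
(* Call f in A^+ X-reduced if no non-trivial element of A_X^+ left-divides it.
   Parabolic submonoids are closed under factors, so if f is an X-reduced
   ribbon X -> Y then the lcm of x in A_X^+ and f is x f, and reduced ribbons
   are closed under composition.  As every atom dividing a positive ribbon from
   X yields some nu_X(s) dividing it, noetherianity writes a positive ribbon as
   p f with p in A_X^+ and f a product of elements nu(X', s), and such products
   are exactly the reduced ribbons; this factorisation is unique.  Since every
   ribbon left-divides some Delta^n, which is itself a ribbon, it follows that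
   reduced ribbons have common right multiples by reduced ribbons, so that R^nu
   consists of fractions a b^-1 of reduced ribbons.  If a b^-1 lies in A_X then
   p a = q b with p, q in A_X^+, hence a = b: R^nu meets A_X trivially, which
   gives uniqueness in both decompositions.  Existence in (ii) reduces to (i): a
   positive conjugator from A_X to A_Y which is reduced on both sides is already
   a ribbon, because an lcm of the numerator and denominator of a conjugated
   element cannot be proper. *)

Require Import Defs.
From mathcomp Require Import all_boot.
From mathcomp Require Import boolp classical_sets.

Set Implicit Arguments.
Unset Strict Implicit.
Unset Printing Implicit Defensive.

Import Algebra.

Local Open Scope classical_set_scope.
Local Open Scope group_scope.

(** * Noetherian induction and conjugation of subsets *)

Lemma noetherian_ind (M : monoidType) (Q : M -> Prop) : noetherian M ->
  (forall w, (forall v, factor v w -> v <> w -> Q v) -> Q w) -> forall w, Q w.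
Proof.
move=> noeM IH w; apply: contrapT => nQw.
(* Every counterexample has a proper factor that is again one; choice iterates this into a chain
   that never becomes constant. *)
pose B := {w | ~ Q w}.
have step (u : B) : exists v : B, factor (sval v) (sval u) /\ sval v <> sval u.
  case: u => u nQu /=; apply: contrapT => nex; apply/nQu/IH => v vu vNu.
  by apply: contrapT => nQv; apply: nex; exists (exist _ v nQv).
have [next nextP] := choice step.
pose f n := iter n next (exist _ w nQw : B).
have [N fN] := noeM (fun n => sval (f n)) (fun n => proj1 (nextP (f n))).
exact: (proj2 (nextP (f N)) (fN N.+1 (leqnSn N))).
Qed.

Lemma conj_setP (A : groupType) (H K : set A) (g : A) :
  (forall x, H x -> K (x ^ g)) -> (forall y, K y -> H (y ^ g^-1)) ->
  conj_set H g = K.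
Proof.
move=> HK KH; apply/seteqP; split=> [_ [x Hx <-]|y Ky]; first exact: HK.
by exists (y ^ g^-1); [apply: KH | rewrite conjgKV].
Qed.

Lemma conj_setl (A : groupType) (H K : set A) (g x : A) :
  conj_set H g = K -> H x -> K (x ^ g).
Proof. by move=> <- Hx; exists x. Qed.

Lemma conj_setV (A : groupType) (H K : set A) (g : A) :
  conj_set H g = K -> conj_set K g^-1 = H.
Proof. by move=> <-; rewrite -conj_setM mulgV conj_set1. Qed.

(** * Divisibility in a Garside monoid *)

Section Fractions.
Variables (M : monoidType) (Delta : M) (hM : garside_structure Delta).
Implicit Types (u v w x y z : M).

Let mulI := garside_lcancel hM.
Let mulJ := garside_rcancel hM.

Lemma garside_conical u v : u * v = 1 -> u = 1 /\ v = 1.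
Proof.
move=> uv1; have u1 : u = 1.
  have [antiM _] := garside_lattice_l hM.
  by apply: antiM; [exists v | exists u; rewrite mul1g].
by move: uv1; rewrite u1 mul1g.
Qed.

Lemma ldvd_antisym v w : ldvd v w -> ldvd w v -> v = w.
Proof. by have [antiM _] := garside_lattice_l hM; apply: antiM. Qed.

Lemma ldvd_trans u v w : ldvd u v -> ldvd v w -> ldvd u w.
Proof. by move=> [a ->] [b ->]; exists (a * b); rewrite mulgA. Qed.

Lemma ldvd_mul2l u v w : ldvd (u * v) (u * w) -> ldvd v w.
Proof. by move=> [a]; rewrite -mulgA => /mulI ->; exists a. Qed.

Lemma factor_neq v w : v <> 1 -> w <> v * w /\ w <> w * v.
Proof.
move=> vN1; split=> [|] Ew; apply: vN1.
  by apply: (@mulJ w); rewrite -Ew mul1g.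
by apply: (@mulI w); rewrite -Ew mulg1.
Qed.

(** By cancellativity, removing a non-trivial left factor leaves a proper factor. *)
Lemma ldvd_ind (Q : M -> Prop) :
  (forall w, (forall v w', w = v * w' -> v <> 1 -> Q w') -> Q w) ->
  forall w, Q w.
Proof.
move=> IH; apply: noetherian_ind (garside_noetherian hM) _ => w IHw.
apply: IH => v w' Ew vN1; apply: IHw.
  by exists v, 1; rewrite mulg1.
by rewrite Ew; have [] := factor_neq w' vN1.
Qed.

Lemma rdvd_ind (Q : M -> Prop) :
  (forall w, (forall v w', w = w' * v -> v <> 1 -> Q w') -> Q w) ->
  forall w, Q w.
Proof.
move=> IH; apply: noetherian_ind (garside_noetherian hM) _ => w IHw.
apply: IH => v w' Ew vN1; apply: IHw.
  by exists 1, v; rewrite mul1g.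
by rewrite Ew; have [] := factor_neq w' vN1.
Qed.

Lemma exists_atom w : w <> 1 -> exists2 s, atom s & ldvd s w.
Proof.
elim/rdvd_ind: w => w IH wN1.
have [atw|natw] := pselect (atom w).
  by exists w => //; exists 1; rewrite mulg1.
have [u [v [Ew uN1 vN1]]] : exists u v, [/\ w = u * v, u <> 1 & v <> 1].
  apply: contrapT => nex; apply: natw; split=> // u v Ew.
  by apply: contrapT => /not_orP[uN1 vN1]; apply: nex; exists u, v.
have [s ats su] := IH v u Ew vN1 uN1.
by exists s => //; apply: ldvd_trans su _; exists v.
Qed.

Lemma atom_ldvd_Delta s : atom s -> ldvd s Delta.
Proof.
have [Phi [_ _ _ PhiP]] := garside_automorphism hM.
by move=> /PhiP [s' [<- _]]; exists s'.
Qed.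

Lemma mul_Delta v : exists w, v * Delta = Delta * w.
Proof.
have [Phi [_ _ PhiE _]] := garside_automorphism hM.
by exists (Phi v); rewrite PhiE.
Qed.

Lemma mul_expDelta v n : exists w, v * Delta ^+ n = Delta ^+ n * w.
Proof.
elim: n v => [|n IHn] v; first by exists v; rewrite expg0 mulg1 mul1g.
have [w Ew] := mul_Delta v; have [z Ez] := IHn w.
by exists z; rewrite expgS mulgA Ew -mulgA Ez mulgA.
Qed.

(** Each atom costs one power: if [Delta = s s'] and [b'] divides [Delta ^+ n], moving [s'] across
    [Delta ^+ n] shows that [s b'] divides [Delta ^+ n.+1]. *)
Lemma ldvd_expDelta b : exists n, ldvd b (Delta ^+ n).
Proof.
elim/ldvd_ind: b => b IH.
have [->|bN1] := pselect (b = 1); first by exists 0%N, 1; rewrite mulg1.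
have [s ats [b' Eb]] := exists_atom bN1.
have [n [c Ec]] := IH s b' Eb (proj1 ats).
have [s' Es'] := atom_ldvd_Delta ats.
have [w Ew] := mul_expDelta s' n.
exists n.+1, (c * w).
by rewrite Eb -mulgA [b' * _]mulgA -Ec -Ew mulgA -Es' expgS.
Qed.

Lemma lcm_exists v w : exists z, is_join (@ldvd M) v w z.
Proof. by have [_ /(_ v w)[]] := garside_lattice_l hM. Qed.

Lemma rlcm_exists v w : exists z, is_join (@rdvd M) v w z.
Proof. by have [_ /(_ v w)[]] := garside_lattice_r hM. Qed.

Variables (A : groupType) (iota : UMagmaMorphism.type M A).
Hypothesis hA : group_of_fractions iota.

Lemma iota_inj : injective iota. Proof. by case: hA. Qed.

Lemma iota1 : iota 1 = 1. Proof. exact: gmulf1. Qed.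

Lemma iotaM v w : iota (v * w) = iota v * iota w. Proof. exact: gmulfM. Qed.

Lemma iota_conj v w g : v * g = g * w -> iota v ^ iota g = iota w.
Proof. by move=> E; rewrite conjgE -iotaM E iotaM mulKg. Qed.

Lemma conj_iota v w g : iota v ^ iota g = iota w -> v * g = g * w.
Proof.
by move=> E; apply: iota_inj; rewrite !iotaM -E conjgE mulVKg.
Qed.

Lemma mul_expDelta_pos g : exists n a, g * iota (Delta ^+ n) = iota a.
Proof.
have [_ /(_ g)[a [b Eg]]] := hA.
have [n [c En]] := ldvd_expDelta b.
by exists n, (a * c); rewrite En Eg !iotaM mulgA mulgVK.
Qed.

(** * Closure of parabolic submonoids under factors *)

Section FactorClosed.
Variable P : set M.
Hypothesis parP : parabolic iota Delta P.

Lemma parabolic1 : P 1. Proof. by case: parP => -[]. Qed.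

Lemma parabolicM x y : P x -> P y -> P (x * y).
Proof. by case: parP => -[_ PM] _ _ _; apply: PM. Qed.

Lemma parabolic_lcm x y z : P x -> P y -> is_join (@ldvd M) x y z -> P z.
Proof. by case: parP => _ PL _ _ Px Py xyz; apply: (PL x y) => //; left. Qed.

Lemma parabolic_rlcm x y z : P x -> P y -> is_join (@rdvd M) x y z -> P z.
Proof. by case: parP => _ _ PL _ Px Py xyz; apply: (PL x y) => //; left. Qed.

(** [delta] acts as a Garside element of [P]. For the last clause, an atom dividing [w] also divides
    [Delta], hence their gcd, which divides [delta]. *)
Lemma parabolic_garside : exists delta, [/\ P delta,
  forall x, P x -> exists2 y, P y & x * delta = delta * y,
  forall y, P y -> exists2 x, P x & x * delta = delta * y,
  forall x, ldvd x delta -> P x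
  & forall s w, atom s -> P w -> ldvd s w -> ldvd s delta].
Proof.
case: parP => _ _ _ [delta [cdelta E1 E2]]; exists delta.
have div_in x : ldvd x delta -> P x.
  move=> xd; have : [set g | ldvd g delta] x by [].
  by rewrite E1 => -[].
split=> //.
- by apply: div_in; exists 1; rewrite mulg1.
- move=> x Px; have : (iota @` P) (iota x ^ iota delta).
    by apply: (conj_setl cdelta); exists x.
  by case=> y Py Ey; exists y => //; apply: conj_iota.
- move=> y Py; have : (iota @` P) (iota y) by exists y.
  rewrite -{1}cdelta => -[_ [x Px <-] Exy].
  by exists x => //; apply: conj_iota.
- move=> s w ats Pw sw.
  have [_ /(_ Delta w)[_ [d dP]]] := garside_lattice_l hM.
  have : [set g | ldvd g delta] d by rewrite E2; exists w.
  by apply: ldvd_trans; case: dP => _ _; apply=> //; apply: atom_ldvd_Delta.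
Qed.

Lemma parabolic_atom s w : atom s -> P w -> ldvd s w -> P s.
Proof.
have [delta [_ _ _ div_in atom_div]] := parabolic_garside.
by move=> ats Pw sw; apply: div_in (atom_div s w ats Pw sw).
Qed.

(* If x * delta^n is in P then its first atom s is complemented in P by
   delta, so that s can be stripped at the cost of one more factor delta. *)
Lemma parabolic_ldiv v w : P (v * w) -> P v /\ P w.
Proof.
have [delta [Pdelta dl dr div_in atom_div]] := parabolic_garside.
(* Cancelling [s] in [s delta = delta s'] gives [delta = t s'], so [t] left-divides [delta]. *)
have compl s t : delta = s * t -> P t.
  move=> Est; apply: (div_in).
  have Ps : P s by apply: div_in; exists t.
  have [s' Ps' Es'] := dl s Ps; exists s'.
  by apply: (@mulI s); rewrite Es' {1}Est mulgA.
have strip s x : atom s -> P (s * x) -> P (x * delta).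
  move=> ats Psx; have [t Et] := atom_div s _ ats Psx (ex_intro _ x erefl).
  have Pt := compl s t Et; have [y Py Ey] := dl _ Psx.
  suff -> : x * delta = t * y by apply: parabolicM.
  by apply: (@mulI s); rewrite mulgA Ey {1}Et -mulgA.
(* The exponent grows while [x] shrinks, so [n] stays quantified in the induction. *)
have unstrip x : forall n, P (x * delta ^+ n) -> P x.
  elim/ldvd_ind: x => x IH n Pxn.
  have [->|xN1] := pselect (x = 1); first exact: parabolic1.
  have [s ats [y Ey]] := exists_atom xN1.
  have Ps : P s.
    apply: parabolic_atom ats Pxn _; apply: ldvd_trans (ex_intro _ y Ey) _.
    by exists (delta ^+ n).
  rewrite Ey; apply: parabolicM => //; apply: (IH s y Ey (proj1 ats) n.+1).
  by rewrite expgSr mulgA; apply: (@strip s) => //; rewrite mulgA -Ey.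
elim/ldvd_ind: v w => v IH w Pvw.
have [v1|vN1] := pselect (v = 1).
  by move: Pvw; rewrite v1 mul1g; split=> //; apply: parabolic1.
have [s ats [y Ey]] := exists_atom vN1.
have Ps : P s.
  by apply: parabolic_atom ats Pvw _; exists (y * w); rewrite Ey mulgA.
have Pyw : P (y * w).
  apply: (@unstrip _ 1%N); rewrite expg1.
  by apply: (@strip s) => //; rewrite mulgA -Ey.
have [Py Pw] := IH s y Ey (proj1 ats) w Pyw.
by split=> //; rewrite Ey; apply: parabolicM.
Qed.

End FactorClosed.

(** * Standard parabolic subgroups as groups of fractions *)

Implicit Types X Y Z : par iota Delta.

Lemma pos1 X : pos X 1. Proof. exact: parabolic1 (par_parabolic X). Qed.

Lemma posM X x y : pos X x -> pos X y -> pos X (x * y).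
Proof. exact: parabolicM (par_parabolic X) _ _. Qed.

Lemma pos_factorl X v w : pos X (v * w) -> pos X v.
Proof. by case/(parabolic_ldiv (par_parabolic X)). Qed.

Lemma pos_factorr X v w : pos X (v * w) -> pos X w.
Proof. by case/(parabolic_ldiv (par_parabolic X)). Qed.

Lemma par_eq X Y : pos X = pos Y -> X = Y.
Proof.
case: X Y => [P parP] [Q parQ] /= E; case: _ / E parQ => parQ.
by congr Par; apply: Prop_irrelevance.
Qed.

Lemma pargroupE X g : pargroup X g <->
  exists a b, [/\ pos X a, pos X b & g = iota a * (iota b)^-1].
Proof.
split=> [Xg|[a [b [Xa Xb ->]]] H [HG HX]]; last first.
  by apply: (proj2 HG); apply: HX; [exists a | exists b].
apply: (Xg [set h | exists a b,
  [/\ pos X a, pos X b & h = iota a * (iota b)^-1]]).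
split=> [|x [a Xa <-]]; last first.
  by exists a, 1; rewrite iota1 invg1 mulg1; split=> //; apply: pos1.
split=> [|_ _ [a [b [Xa Xb ->]]] [c [d [Xc Xd ->]]]].
  by exists 1, 1; rewrite iota1 mulgV; split=> //; apply: pos1.
(* The lcm [z = b u = d v] rewrites [b^-1 d] as [u v^-1]. *)
have [z bdz] := lcm_exists b d.
have Xz := parabolic_lcm (par_parabolic X) Xb Xd bdz.
have [[u Eu] [v Ev] _] := bdz.
exists (a * u), (c * v); split.
- by apply: posM => //; apply: (@pos_factorr _ b); rewrite -Eu.
- by apply: posM => //; apply: (@pos_factorr _ d); rewrite -Ev.
have /(congr1 iota) : b * u = d * v by rewrite -Eu.
rewrite !iotaM => E.
have -> : iota v = (iota d)^-1 * (iota b * iota u) by rewrite E mulKg.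
by rewrite !invgM !invgK !mulgA mulgK.
Qed.

(** The right lcm [u a = v b] turns [a b^-1] into [u^-1 v]. *)
Lemma pargroup_frac X g : pargroup X g ->
  exists a b, [/\ pos X a, pos X b & g = (iota b)^-1 * iota a].
Proof.
move=> /pargroupE [a [b [Xa Xb ->]]].
have [z abz] := rlcm_exists a b.
have Xz := parabolic_rlcm (par_parabolic X) Xa Xb abz.
have [[u Eu] [v Ev] _] := abz.
exists v, u; split.
- by apply: (@pos_factorl _ _ b); rewrite -Ev.
- by apply: (@pos_factorl _ _ a); rewrite -Eu.
have /(congr1 iota) : u * a = v * b by rewrite -Eu.
rewrite !iotaM => E; have -> : iota v = iota u * iota a * (iota b)^-1.
  by rewrite E mulgK.
by rewrite -mulgA mulKg.
Qed.

(** If [a] equals a fraction [b c^-1], then [a c = b] lies in [pos X], and closure under factors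
    applies. *)
Lemma pargroup_pos X a : pargroup X (iota a) <-> pos X a.
Proof.
split=> [|Xa H [_ HX]]; last by apply: HX; exists a.
move=> /pargroupE[b [c [Xb Xc E]]].
apply: (@pos_factorl _ _ c).
by have -> : a * c = b by apply: iota_inj; rewrite iotaM E mulgVK.
Qed.

Lemma pargroupV X g : pargroup X g -> pargroup X g^-1.
Proof.
move=> /pargroupE[b [c [Xb Xc ->]]]; apply/pargroupE.
by exists c, b; rewrite invgM invgK.
Qed.

(** * Ribbons, quasi-centralizers and conjugation by [Delta] *)

Lemma ribbon_conj X Y g : ribbon_mor X Y g -> conj_mor X Y g.
Proof.
have sub X' Y' h : ribbon_mor X' Y' h -> forall x : A, pargroup X' x ->
    pargroup Y' (x ^ h).
  move=> hXY x /pargroupE[a [b [Xa Xb ->]]]; apply/pargroupE.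
  have [|c Yc Ec] := conj_setl hXY (_ : parmonoid X' (iota a)).
    by exists a.
  have [|d Yd Ed] := conj_setl hXY (_ : parmonoid X' (iota b)).
    by exists b.
  by exists c, d; rewrite conjMg conjVg -Ec -Ed.
move=> gXY; apply: conj_setP; first exact: sub.
by apply: sub; apply: conj_setV.
Qed.

Lemma pribbonP X Y f : pribbon_mor X Y f <->
  (forall x, pos X x -> exists2 y, pos Y y & x * f = f * y) /\
  (forall y, pos Y y -> exists2 x, pos X x & x * f = f * y).
Proof.
split=> [fXY|[XY YX]].
  split=> [x Xx|y Yy].
    have [|y Yy Ey] := conj_setl fXY (_ : parmonoid X (iota x)).
      by exists x.
    by exists y => //; apply: conj_iota.
  have : parmonoid Y (iota y) by exists y.
  by rewrite -fXY => -[_ [x Xx <-] E]; exists x => //; apply: conj_iota.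
apply/seteqP; split=> [_ [_ [x Xx <-] <-]|_ [y Yy <-]].
  by have [y Yy /iota_conj ->] := XY x Xx; exists y.
by have [x Xx /iota_conj <-] := YX y Yy; exists (iota x) => //; exists x.
Qed.

Lemma qzE X g : qz X g <-> pargroup X g /\ ribbon_mor X X g.
Proof.
split=> -[Xg Eg]; split=> //.
  apply: conj_setP => x Xx.
    have : [set g * y | y in parmonoid X] (x * g) by rewrite Eg; exists x.
    by case=> y Xy Ey; rewrite conjgE -Ey mulKg.
  have : [set y * g | y in parmonoid X] (g * x) by rewrite -Eg; exists x.
  by case=> y Xy Ey; rewrite conjgE invgK mulgA -Ey mulgK.
apply/seteqP; split=> _ [x Xx <-].
  exists (x ^ g^-1); first exact: conj_setl (conj_setV Eg) Xx.
  by rewrite conjgE invgK mulgA mulgVK.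
by exists (x ^ g); [apply: conj_setl Eg Xx | rewrite -conjgC].
Qed.

(** Conjugation by [Delta] is the automorphism [Phi], which fixes [Delta], so the whole definition
    of a parabolic submonoid is transported, with [Phi delta] in place of [delta]. *)
Lemma par_shift X : exists Y, pribbon_mor X Y Delta.
Proof.
have [Phi [[Phi1 PhiM] [Psi PhiK PsiK] PhiE _]] := garside_automorphism hM.
have PsiM v w : Psi (v * w) = Psi v * Psi w.
  by rewrite -{1}[v]PsiK -{1}[w]PsiK -PhiM PhiK.
have Psi1 : Psi 1 = 1 by rewrite -Phi1 PhiK.
have PhiD : Phi Delta = Delta by apply: mulI (PhiE Delta).
have PsiD : Psi Delta = Delta by rewrite -{1}PhiD PhiK.
have ldvd_Psi v w : ldvd (Psi v) w <-> ldvd v (Phi w).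
  split=> -[u Eu]; [exists (Phi u) | exists (Psi u)].
    by rewrite Eu PhiM PsiK.
  by rewrite -[w]PhiK Eu PsiM.
have rdvd_Psi v w : rdvd (Psi v) w <-> rdvd v (Phi w).
  split=> -[u Eu]; [exists (Phi u) | exists (Psi u)].
    by rewrite Eu PhiM PsiK.
  by rewrite -[w]PhiK Eu PsiM.
have join_Psi (le : M -> M -> Prop) x y z :
    (forall v w, le (Psi v) w <-> le v (Phi w)) ->
    is_join le x y z -> is_join le (Psi x) (Psi y) (Psi z).
  move=> lePsi [xz yz zmin]; split.
  - by apply/lePsi; rewrite PsiK.
  - by apply/lePsi; rewrite PsiK.
  by move=> w /lePsi xw /lePsi yw; apply/lePsi/zmin.
have meet_Psi (le : M -> M -> Prop) x y z :
    (forall v w, le (Psi v) w <-> le v (Phi w)) ->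
    is_meet le x y z -> is_meet le (Psi x) (Psi y) (Psi z).
  move=> lePsi [zx zy zmax]; split.
  - by apply/lePsi; rewrite PsiK.
  - by apply/lePsi; rewrite PsiK.
  move=> w; rewrite -[w]PhiK !lePsi !PsiK; exact: zmax.
have lattice_Psi (le : M -> M -> Prop) :
    (forall v w, le (Psi v) w <-> le v (Phi w)) ->
    is_sublattice le (pos X) -> is_sublattice le [set v | pos X (Psi v)].
  move=> lePsi latX x y z Xx Xy [xyz|xyz]; apply: latX Xx Xy _.
    by left; apply: join_Psi.
  by right; apply: meet_Psi.
have [_ latX rlatX [delta [cdelta E1 E2]]] := par_parabolic X.
have conjD : conj_set (parmonoid X) (iota Delta) =
    iota @` [set v | pos X (Psi v)].
  apply/seteqP; split=> [_ [_ [x Xx <-] <-]|_ [y Xy <-]].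
    by exists (Phi x); [rewrite /= PhiK | rewrite (iota_conj (esym (PhiE x)))].
  exists (iota (Psi y)); first by exists (Psi y).
  by rewrite (iota_conj (esym (PhiE _))) PsiK.
suff parY : parabolic iota Delta [set v | pos X (Psi v)].
  by exists (Par parY).
split.
- split=> [|x y /= Xx Xy]; first by rewrite /= Psi1; apply: pos1.
  by rewrite PsiM; apply: posM.
- exact: lattice_Psi.
- exact: lattice_Psi.
exists (Phi delta); split.
- rewrite -conjD -(iota_conj (esym (PhiE delta))) -conj_setM -conjgC conj_setM.
  by rewrite cdelta.
- apply/seteqP; split=> v /=; rewrite -ldvd_Psi.
    move=> vd; have : [set g | ldvd g delta] (Psi v) by [].
    by rewrite E1 => -[Xv]; rewrite ldvd_Psi PhiD.
  move=> [Xv vD]; suff : [set g | ldvd g delta] (Psi v) by [].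
  by rewrite E1; split=> //; rewrite ldvd_Psi PhiD.
apply/seteqP; split=> v /=; rewrite -ldvd_Psi.
  move=> vd; have : [set g | ldvd g delta] (Psi v) by [].
  rewrite E2 => -[p Xp [mD mp mmax]]; exists (Phi p); first by rewrite PhiK.
  split; [by move/ldvd_Psi: mD; rewrite PhiD | exact/ldvd_Psi |].
  move=> w; rewrite -{1}PhiD -!ldvd_Psi => wD wp.
  by rewrite -[v]PsiK -ldvd_Psi; apply: mmax.
move=> [p Xp mp]; suff : [set g | ldvd g delta] (Psi v) by [].
by rewrite E2; exists (Psi p) => //; rewrite -PsiD; apply: meet_Psi.
Qed.

Lemma par_shift_exp X n : exists Y, pribbon_mor X Y (Delta ^+ n).
Proof.
elim: n => [|n [Y XY]]; first by exists X; rewrite expg0; apply: pribbon_id.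
have [Z YZ] := par_shift Y.
by exists Z; rewrite expgSr; apply: pribbon_comp YZ.
Qed.

(** * Reduced elements and reduced ribbons *)

Definition reduced X f : Prop := forall x, pos X x -> ldvd x f -> x = 1.

Definition reduced_ribbon X Y f : Prop := pribbon_mor X Y f /\ reduced X f.

Lemma exists_reduced X f : exists p f', [/\ pos X p, f = p * f' & reduced X f'].
Proof.
elim/ldvd_ind: f => f IH.
have [rf|nrf] := pselect (reduced X f).
  by exists 1, f; rewrite mul1g; split=> //; apply: pos1.
have [x [Xx [f' Ef] xN1]] : exists x, [/\ pos X x, ldvd x f & x <> 1].
  apply: contrapT => nex; apply: nrf => x Xx xf.
  by apply: contrapT => xN1; apply: nex; exists x.
have [p [f'' [Xp Ef' rf'']]] := IH x f' Ef xN1.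
exists (x * p), f''; split=> //; first exact: posM.
by rewrite Ef Ef' mulgA.
Qed.

Lemma reduced_ldvd X f g : ldvd g f -> reduced X f -> reduced X g.
Proof. by move=> gf rf x Xx xg; apply: rf => //; apply: ldvd_trans xg gf. Qed.

(** The lcm of [p] and [q] is [p u] with [u] in A_X^+ and divides [p f], so [u] divides the reduced
    [f] and is trivial: [q] divides [p]. The converse is symmetric. *)
Lemma reduced_part_unique X p q f g : pos X p -> pos X q -> reduced X f ->
  reduced X g -> p * f = q * g -> p = q /\ f = g.
Proof.
have div p' q' f' : pos X p' -> pos X q' -> reduced X f' ->
    ldvd q' (p' * f') -> ldvd q' p'.
  move=> Xp Xq rf qpf; have [z [[u Eu] [v Ev] zmin]] := lcm_exists p' q'.
  have Xz : pos X z.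
    by apply: (parabolic_lcm (par_parabolic X) Xp Xq); split;
      [exists u | exists v |].
  have Xu : pos X u by apply: (@pos_factorr _ p'); rewrite -Eu.
  have u1 : u = 1.
    apply: rf => //; apply: (@ldvd_mul2l p').
    by rewrite -Eu; apply: zmin => //; exists f'.
  by exists v; rewrite -Ev Eu u1 mulg1.
move=> Xp Xq rf rg E.
have pq : p = q.
  apply: ldvd_antisym.
    by apply: (div q p g) => //; rewrite -E; exists f.
  by apply: (div p q f) => //; rewrite E; exists g.
by split=> //; move: E; rewrite pq => /mulI.
Qed.

(* Factor-closedness of the target of f makes x f the lcm of x and f. *)
Lemma reduced_ribbon_lcm X Y f x g : reduced_ribbon X Y f -> pos X x ->
  ldvd x (f * g) -> ldvd (x * f) (f * g).
Proof.
move=> [/pribbonP[XY YX] rf] Xx xfg.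
have [z [[u Eu] [w Ew] zmin]] := lcm_exists x f.
have [x' Yx' Ex'] := XY x Xx.
have [w' Ew'] : ldvd w x'.
  apply: (@ldvd_mul2l f); rewrite -Ew -Ex'.
  by apply: zmin; [exists f | exists x'].
have [Yw Yw'] : pos Y w /\ pos Y w'.
  rewrite Ew' in Yx'.
  by split; [apply: pos_factorl Yx' | apply: pos_factorr Yx'].
(* Pulling [x' = w w'] back through [f] splits [x] as [p1 p2]; since [z = p1 f = x u], the factor
   [p2] divides [f]. *)
have [p1 Xp1 E1] := YX w Yw; have [p2 Xp2 E2] := YX w' Yw'.
have Exp : x = p1 * p2.
  by apply: (@mulJ f); rewrite Ex' Ew' mulgA -E1 -!mulgA E2.
have p21 : p2 = 1.
  apply: rf => //; apply: (@ldvd_mul2l p1).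
  by rewrite -Exp E1 -Ew Eu; exists u.
rewrite Exp p21 mulg1 E1 -Ew; apply: zmin => //; by exists g.
Qed.

(** If [x] divides [f g], so does [x f = f y] with [y] in A_Y^+; then [y] divides [g], so [y] and
    [x] are trivial. *)
Lemma reduced_ribbonM X Y Z f g : reduced_ribbon X Y f ->
  reduced_ribbon Y Z g -> reduced_ribbon X Z (f * g).
Proof.
move=> fXY [gYZ rg]; split; first exact: pribbon_comp (proj1 fXY) gYZ.
move=> x Xx xfg; have := reduced_ribbon_lcm fXY Xx xfg.
have [/pribbonP[XY _] rf] := fXY; have [y Yy Ey] := XY x Xx.
rewrite Ey => /ldvd_mul2l/rg y1.
by apply: (@mulJ f); rewrite Ey y1 // mulg1 mul1g.
Qed.

(* The label normalises A_X, and A_X determines A_X^+ as A_X `&` A^+. *)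
Lemma pos_pribbon X Y f : pos X f -> pribbon_mor X Y f -> X = Y.
Proof.
move=> Xf /ribbon_conj; rewrite /conj_mor /= => E.
have {}E : pargroup X = pargroup Y.
  have XG := (pargroup_pos X f).2 Xf.
  rewrite -E; apply/esym/conj_setP => g Xg; rewrite conjgE.
    by do 2?[apply: pargroupM] => //; apply: pargroupV.
  by do 2?[apply: pargroupM] => //; rewrite ?invgK //; apply: pargroupV.
apply/par_eq/seteqP; split=> a.
  by move=> /pargroup_pos; rewrite E => /pargroup_pos.
by move=> /pargroup_pos; rewrite -E => /pargroup_pos.
Qed.

Lemma pribbon_divl X Y Z f g :
  pribbon_mor X Y f -> pribbon_mor X Z (f * g) -> pribbon_mor Y Z g.
Proof.
rewrite /pribbon_mor /= iotaM => fXY fgXZ; rewrite -[iota g](mulKg (iota f)).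
by apply: ribbon_comp fgXZ; apply: conj_setV.
Qed.

(** * Conjugators between standard parabolic subgroups *)

Lemma conj_reduced_ribbon X Y h : conj_mor X Y (iota h) -> reduced X h ->
  (forall y, pos Y y -> rdvd y h -> y = 1) -> pribbon_mor X Y h.
Proof.
move=> hXY rh rrh; apply/pribbonP; split=> [x Xx|y Yy].
  have /pargroupE[a [b [Ya Yb E]]] : pargroup Y (iota x ^ iota h).
    by apply: (conj_setl hXY); apply/pargroup_pos.
  have {}E : x * h * b = h * a.
    apply: iota_inj; rewrite !iotaM.
    by rewrite [iota x * _]conjgC E mulgA mulgVK.
  have [z abz] := rlcm_exists a b.
  have Yz := parabolic_rlcm (par_parabolic Y) Ya Yb abz.
  have [[c Ec] [d Ed] zmin] := abz.
  have [e Ee] : rdvd z (h * a).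
    by apply: zmin; [exists h | exists (x * h)].
  (* [z = c a] right-divides [h a = x h b], so [c] right-divides [h], which is reduced on the
     right. *)
  have c1 : c = 1.
    apply: rrh; first by apply: (@pos_factorl _ _ a); rewrite -Ec.
    by exists e; apply: (@mulJ a); rewrite Ee Ec mulgA.
  have Ead : a = d * b by rewrite -Ed Ec c1 mul1g.
  exists d; first by apply: (@pos_factorl _ _ b); rewrite -Ead.
  by apply: (@mulJ b); rewrite E Ead mulgA.
(* Mirror image, with left fractions and the left lcm. *)
have /pargroup_frac[a [b [Xa Xb E]]] : pargroup X (iota y ^ (iota h)^-1).
  by apply: (conj_setl (conj_setV hXY)); apply/pargroup_pos.
have {}E : b * (h * y) = a * h.
  apply: iota_inj; rewrite !iotaM; move: E; rewrite conjgE invgK => E.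
  have -> : iota a = iota b * (iota h * (iota y * (iota h)^-1)).
    by rewrite E mulVKg.
  by rewrite -!mulgA mulVg mulg1.
have [z abz] := lcm_exists a b.
have Xz := parabolic_lcm (par_parabolic X) Xa Xb abz.
have [[c Ec] [d Ed] zmin] := abz.
have [e Ee] : ldvd z (a * h).
  by apply: zmin; [exists h | exists (h * y)].
have c1 : c = 1.
  apply: rh; first by apply: (@pos_factorr _ a); rewrite -Ec.
  by exists e; apply: (@mulI a); rewrite Ee Ec mulgA.
have Ead : a = b * d by rewrite -Ed Ec c1 mulg1.
exists d; first by apply: (@pos_factorr _ b); rewrite -Ead.
by apply: (@mulI b); rewrite E Ead mulgA.
Qed.

Lemma exists_rreduced X f : exists p f', [/\ pos X p, f = f' * p
  & forall x, pos X x -> rdvd x f' -> x = 1].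
Proof.
elim/rdvd_ind: f => f IH.
have [rf|nrf] := pselect (forall x, pos X x -> rdvd x f -> x = 1).
  by exists 1, f; rewrite mulg1; split=> //; apply: pos1.
have [x [Xx [f' Ef] xN1]] : exists x, [/\ pos X x, rdvd x f & x <> 1].
  apply: contrapT => nex; apply: nrf => x Xx xf.
  by apply: contrapT => xN1; apply: nex; exists x.
have [p [f'' [Xp Ef' rf'']]] := IH x f' Ef xN1.
exists (p * x), f''; split=> //; first exact: posM.
by rewrite Ef Ef' mulgA.
Qed.

Lemma pargroup_conj X g : pargroup X g -> conj_mor X X g.
Proof.
move=> Xg; apply: conj_setP => h Xh; rewrite conjgE.
  by do 2?[apply: pargroupM] => //; apply: pargroupV.
by rewrite invgK; do 2?[apply: pargroupM] => //; apply: pargroupV.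
Qed.

(** A power of [Delta], itself a ribbon, makes the conjugator positive. Removing A_X^+ on the left
    and A_Z^+ on the right leaves a ribbon [h], and the right-hand factor is conjugated across [h]
    into A_X. *)
Lemma conj_decomp X Y g : conj_mor X Y g ->
  exists q f, [/\ pargroup X q, ribbon_mor X Y f & g = q * f].
Proof.
move=> gXY; have [n [a Ea]] := mul_expDelta_pos g.
have [Z YZ] := par_shift_exp Y n.
have aXZ : conj_mor X Z (iota a).
  by rewrite -Ea; apply: conj_comp gXY (ribbon_conj YZ).
have [p [a' [Xp Ea' ra']]] := exists_reduced X a.
have [q [h [Zq Eh rrh]]] := exists_rreduced Z a'.
have hXZ : conj_mor X Z (iota h).
  have -> : iota h = (iota p)^-1 * (iota a * (iota q)^-1).
    by rewrite Ea' Eh !iotaM !mulgA mulVg mul1g mulgK.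
  have pX := pargroup_conj (pargroupV ((pargroup_pos X p).2 Xp)).
  have qZ := pargroup_conj (pargroupV ((pargroup_pos Z q).2 Zq)).
  exact: conj_comp pX (conj_comp aXZ qZ).
have rh : reduced X h by apply: reduced_ldvd ra'; exists q.
have {}rrh := conj_reduced_ribbon hXZ rh rrh.
pose k := iota h * (iota (Delta ^+ n))^-1.
have kXY : ribbon_mor X Y k.
  by apply: ribbon_comp rrh _; apply: conj_setV.
exists (g * k^-1), k; split=> //; last by rewrite mulgVK.
have -> : g * k^-1 = iota p * iota q ^ (iota h)^-1.
  rewrite conjgE invgK /k invgM invgK mulgA Ea Ea' Eh !iotaM.
  by rewrite !mulgA.
apply: pargroupM; first by apply/pargroup_pos.
by apply: (conj_setl (conj_setV hXZ)); apply/pargroup_pos.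
Qed.

Lemma conj_mor_coset X Y g : conj_mor X Y g ->
  [set h * g | h in pargroup X] = [set g * h | h in pargroup Y].
Proof.
move=> gXY; apply/seteqP; split=> _ [h Xh <-].
  by exists (h ^ g); [apply: conj_setl gXY Xh | rewrite -conjgC].
exists (h ^ g^-1); first exact: conj_setl (conj_setV gXY) Xh.
by rewrite conjgE invgK mulgA mulgVK.
Qed.

(** * Values of [nu] and positive ribbons *)

Section Nu.
Variables nu nu' : par iota Delta -> atoms M -> M.
Hypothesis hnu : nu_structure nu nu'.

Lemma nu_neq1 X s : nu X s <> 1.
Proof.
move=> nu1; have [Y [XY nid _]] := nu_atom hnu X s.
apply: nid; split=> //; apply: pos_pribbon XY.
by rewrite nu1; apply: pos1.
Qed.

(** If an atom [t] of A_X^+ divides [nu X s], then so does [nu X t], and the two are equal by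
    atomicity. But [t] also divides [delta], a ribbon from [X] to [X], so [nu X t] divides [delta]
    and lies in A_X^+. *)
Lemma nu_reduced X s : ~ pos X (nu X s) -> reduced X (nu X s).
Proof.
move=> nXa x Xx xa; apply: contrapT => xN1; apply: nXa.
have [t att tx] := exists_atom xN1.
have Xt := parabolic_atom (par_parabolic X) att Xx tx.
have [Y [XY _ Yat]] := nu_atom hnu X s.
have [w Ew] := nu_ldvd hnu (s := exist _ t att) XY (ldvd_trans tx xa).
have [Z [XZ _ _]] := nu_atom hnu X (exist _ t att).
have ZY : pribbon_mor Z Y w by apply: pribbon_divl XZ _; rewrite -Ew.
case: (Yat Z _ _ XZ ZY Ew) => -[_ E]; first by case: (nu_neq1 E).
have [delta [Xdelta dl dr _ atom_div]] := parabolic_garside (par_parabolic X).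
have dX : pribbon_mor X X delta by apply/pribbonP.
have td := atom_div t x att Xx tx.
have [c Ec] := nu_ldvd hnu (s := exist _ t att) dX td.
by rewrite Ew E mulg1; apply: (@pos_factorl _ _ c); rewrite -Ec.
Qed.

Lemma nu_groupoid_nu X Y s : ~ pos X (nu X s) -> pribbon_mor X Y (nu X s) ->
  nu_groupoid nu X Y (iota (nu X s)).
Proof. by move=> nXa XY D _ _; apply; exists s. Qed.

Lemma nu_groupoidV X Y g : nu_groupoid nu X Y g -> nu_groupoid nu Y X g^-1.
Proof. by move=> gXY D DR DV GD; apply: (DV _ _ _ (gXY D DR DV GD)). Qed.

(* The factors nu(X, s) lying in A_X^+ are pushed to the left. *)
Lemma pribbon_decomp X Y m : pribbon_mor X Y m ->
  exists p f, [/\ pos X p, m = p * f, reduced_ribbon X Y f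
    & nu_groupoid nu X Y (iota f)].
Proof.
elim/ldvd_ind: m X => m IH X mXY.
have [m1|mN1] := pselect (m = 1).
  have <- : X = Y by apply: pos_pribbon mXY; rewrite m1; apply: pos1.
  exists 1, 1; rewrite mulg1 iota1; split=> //.
  - exact: pos1.
  - split; first exact: pribbon_id.
    by move=> x _ [y /esym /garside_conical[]].
  - exact: mor_id.
have [s ats sm] := exists_atom mN1.
pose a := nu X (exist _ s ats).
have [m' Em] : ldvd a m by apply: (nu_ldvd hnu (s := exist _ s ats) mXY sm).
have [Z [XZ _ _]] := nu_atom hnu X (exist _ s ats).
have ZY : pribbon_mor Z Y m' by apply: pribbon_divl XZ _; rewrite -Em.
have [p [f [Zp Em' fZY fnu]]] := IH a m' Em (@nu_neq1 _ _) Z ZY.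
have [Xa|nXa] := pselect (pos X a).
  have EZ := pos_pribbon Xa XZ; move: Zp fZY fnu; rewrite -EZ => Xp fXY fnu.
  by exists (a * p), f; split=> //; [apply: posM | rewrite Em Em' mulgA].
have [p' Xp' Ep'] := (proj2 ((pribbonP X Z a).1 XZ)) p Zp.
exists p', (a * f); split=> //.
- by rewrite Em Em' !mulgA Ep'.
- by apply: reduced_ribbonM fZY; split=> //; apply: nu_reduced.
by rewrite iotaM; apply: mor_comp fnu; apply: nu_groupoid_nu.
Qed.

(** * Fractions of reduced ribbons *)

Definition reduced_fraction X Y (g : A) : Prop := exists Z a b,
  [/\ reduced_ribbon X Z a, reduced_ribbon Y Z b & g = iota a * (iota b)^-1].

Lemma reduced_fraction_pribbon X Y f :
  reduced_ribbon X Y f -> reduced_fraction X Y (iota f).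
Proof.
move=> fXY; exists Y, f, 1; rewrite iota1 invg1 mulg1; split=> //.
split; first exact: pribbon_id.
by move=> x _ [y /esym /garside_conical[]].
Qed.

Lemma reduced_fraction1 X : reduced_fraction X X 1.
Proof.
rewrite -iota1; apply: reduced_fraction_pribbon; split; first exact: pribbon_id.
by move=> x _ [y /esym /garside_conical[]].
Qed.

Lemma reduced_fractionV X Y g :
  reduced_fraction X Y g -> reduced_fraction Y X g^-1.
Proof.
move=> [Z [a [b [aXZ bYZ ->]]]]; exists Z, b, a; split=> //.
by rewrite invgM invgK.
Qed.

(* The ribbons Delta^n, which every ribbon divides for n large, provide the
   common multiples; their factors in the parabolic submonoids drop out by
   uniqueness. *)
Lemma reduced_ribbon_ore X Y Z b c :
  reduced_ribbon X Y b -> reduced_ribbon X Z c ->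
  exists W u v, [/\ reduced_ribbon Y W u, reduced_ribbon Z W v & b * u = c * v].
Proof.
move=> bXY cXZ.
have [n [b' Eb]] : exists n, ldvd b (Delta ^+ n) by apply: ldvd_expDelta.
have [m [c' Ec]] : exists m, ldvd c (Delta ^+ m) by apply: ldvd_expDelta.
have [c'' Ec''] := mul_expDelta c' n.
have [W XW] := par_shift_exp X (m + n).
have Ebc : b * (b' * Delta ^+ m) = c * (c' * Delta ^+ n).
  by rewrite !mulgA -Eb -Ec -!expgnDr addnC.
have XWc : pribbon_mor X W (c * (c' * Delta ^+ n)).
  by rewrite mulgA -Ec -expgnDr.
have XWb : pribbon_mor X W (b * (b' * Delta ^+ m)) by rewrite Ebc.
have [p [u [Yp Eu uYW _]]] := pribbon_decomp (pribbon_divl (proj1 bXY) XWb).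
have [q [v [Zq Ev vZW _]]] := pribbon_decomp (pribbon_divl (proj1 cXZ) XWc).
have [p' Xp' Ep'] := (proj2 ((pribbonP X Y b).1 (proj1 bXY))) p Yp.
have [q' Xq' Eq'] := (proj2 ((pribbonP X Z c).1 (proj1 cXZ))) q Zq.
exists W, u, v; split=> //.
have E : p' * (b * u) = q' * (c * v).
  by rewrite !mulgA Ep' Eq' -!mulgA -Eu -Ev.
have [_ rbu] := reduced_ribbonM bXY uYW.
have [_ rcv] := reduced_ribbonM cXZ vZW.
by have [] := reduced_part_unique Xp' Xq' rbu rcv E.
Qed.

(** A common multiple [b u = c v] replaces the inner quotient [b^-1 c] by [u v^-1]. *)
Lemma reduced_fractionM X Y Z g h : reduced_fraction X Y g ->
  reduced_fraction Y Z h -> reduced_fraction X Z (g * h).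
Proof.
move=> [U [a [b [aXU bYU ->]]]] [V [c [d [cYV dZV ->]]]].
have [W [u [v [uUW vVW /(congr1 iota)]]]] := reduced_ribbon_ore bYU cYV.
rewrite !iotaM => E.
exists W, (a * u), (d * v); split.
- exact: reduced_ribbonM uUW.
- exact: reduced_ribbonM vVW.
have -> : iota c = iota b * iota u * (iota v)^-1 by rewrite E mulgK.
by rewrite !iotaM invgM !mulgA mulgVK.
Qed.

(** Bundled to instantiate the quantifier over subgroupoids in [generated_mor]. *)
Definition reduced_groupoid : mcat A (par iota Delta) :=
  MCat reduced_fraction1 reduced_fractionM.

Lemma reduced_fraction_ribbon X Y g :
  reduced_fraction X Y g -> ribbon_mor X Y g.
Proof.
move=> [Z [a [b [[aXZ _] [bYZ _] ->]]]].
by apply: ribbon_comp aXZ _; apply: conj_setV.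
Qed.

Lemma nu_groupoid_reduced X Y g :
  nu_groupoid nu X Y g -> reduced_fraction X Y g.
Proof.
move=> /(_ reduced_groupoid); apply.
- by move=> x y h; apply: reduced_fraction_ribbon.
- by move=> x y h; apply: reduced_fractionV.
move=> x y _ [s [nXs xy ->]].
by apply: reduced_fraction_pribbon; split=> //; apply: nu_reduced.
Qed.

(** As source and target agree, [a] and [b] are reduced for the same [X]. Writing [g] as a left
    fraction [q^-1 p] gives [q a = p b], to which uniqueness of the reduced part applies. *)
Lemma nu_groupoid_pargroup X g :
  nu_groupoid nu X X g -> pargroup X g -> g = 1.
Proof.
move=> /nu_groupoid_reduced[Z [a [b [[_ ra] [_ rb] ->]]]].
move=> /pargroup_frac[p [q [Xp Xq E]]].
have {}E : q * a = p * b.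
  apply: iota_inj; rewrite !iotaM -[iota a](mulgVK (iota b)) E.
  by rewrite !mulgA mulgV mul1g.
have [_ ->] := reduced_part_unique Xq Xp ra rb E.
by rewrite mulgV.
Qed.

(** * The two semi-direct products *)

Lemma nu_groupoid_ribbon X Y g : nu_groupoid nu X Y g -> ribbon_mor X Y g.
Proof. by move=> /nu_groupoid_reduced/reduced_fraction_ribbon. Qed.

(** With [a = p f] and [Delta ^+ n = r h], one gets [g = p k r^-1] for [k = f h^-1]; conjugation
    across [k] moves [r^-1] into A_X. *)
Lemma ribbon_decomp X Y g : ribbon_mor X Y g ->
  exists q f, [/\ pargroup X q, nu_groupoid nu X Y f & g = q * f].
Proof.
move=> gXY; have [n [a Ea]] := mul_expDelta_pos g.
have [Z YZ] := par_shift_exp Y n.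
have aXZ : pribbon_mor X Z a.
  by rewrite /pribbon_mor /= -Ea; apply: ribbon_comp gXY YZ.
have [p [f [Xp Ef _ fnu]]] := pribbon_decomp aXZ.
have [r [h [Yr Eh _ hnu']]] := pribbon_decomp YZ.
pose k := iota f * (iota h)^-1.
have kXY : nu_groupoid nu X Y k by apply: mor_comp fnu (nu_groupoidV hnu').
exists (g * k^-1), k; split=> //; last by rewrite mulgVK.
have -> : g * k^-1 = iota p * (iota r)^-1 ^ k^-1.
  rewrite conjgE invgK /k invgM invgK.
  have -> : g = iota a * (iota (Delta ^+ n))^-1 by rewrite -Ea mulgK.
  by rewrite Ef Eh !iotaM invgM !mulgA.
apply: pargroupM; first by apply/pargroup_pos.
apply: (conj_setl (conj_setV (ribbon_conj (nu_groupoid_ribbon kXY)))).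
by apply: pargroupV; apply/pargroup_pos.
Qed.

(** [f f'^-1 = q^-1 q'] lies both in A_X and in [nu_groupoid nu]. Taking [q] in A_X serves both
    decompositions, as QZ(A_X) is contained in A_X. *)
Lemma nu_decomp_unique X Y g q f : pargroup X q -> nu_groupoid nu X Y f ->
  g = q * f -> forall q' f', pargroup X q' -> nu_groupoid nu X Y f' ->
  g = q' * f' -> (q, f) = (q', f').
Proof.
move=> Xq fXY -> q' f' Xq' fXY' E.
have Eq : f * f'^-1 = q^-1 * q'.
  by rewrite -[f](mulKg q) E -!mulgA mulgV mulg1.
have f1 : f * f'^-1 = 1.
  apply: (@nu_groupoid_pargroup X); first
    exact: mor_comp fXY (nu_groupoidV fXY').
  by rewrite Eq; apply: pargroupM => //; apply: pargroupV.
have ff' : f = f' by apply: divg1_eq.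
by move: E; rewrite ff' => /mulIg ->.
Qed.

Lemma ribbon_semidirect :
  semidirect (ribbon iota Delta) (qz_groupoid iota Delta) (nu_groupoid nu).
Proof.
split.
- by move=> X _ g [<- /qzE[]].
- by move=> X Y g; apply: nu_groupoid_ribbon.
- by move=> X Y g [].
- move=> X Y g gXY; have [q [f [Xq fXY Eg]]] := ribbon_decomp gXY.
  exists (X, (q, f)); split=> [|[_ [q' f']] [/= [<- /qzE[Xq' _]] fXY' Eg']].
    split=> //; split=> //; apply/qzE; split=> //.
    (* A quotient of two ribbons from [X] to [Y] normalises A_X^+, so [q] is quasi-central. *)
    have -> : q = g * f^-1 by rewrite Eg mulgK.
    by apply: ribbon_comp gXY _; apply: conj_setV (nu_groupoid_ribbon fXY).
  by rewrite (nu_decomp_unique Xq fXY Eg Xq' fXY' Eg').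
move=> X Y g gXY; have rXY := nu_groupoid_ribbon gXY.
have cXY := conj_mor_coset (ribbon_conj rXY).
apply/seteqP; split=> _ [h [_ /qzE[Xh hXX]] <-].
  have : [set g * k | k in pargroup Y] (h * g) by rewrite -cXY; exists h.
  case=> k Yk Ek; exists k => //; split=> //; apply/qzE; split=> //.
  have -> : k = g^-1 * (h * g) by rewrite -Ek mulKg.
  apply: ribbon_comp (conj_setV rXY) _; exact: ribbon_comp hXX rXY.
have : [set k * g | k in pargroup X] (g * h) by rewrite cXY; exists h.
case=> k Yk Ek; exists k => //; split=> //; apply/qzE; split=> //.
have -> : k = g * h * g^-1 by rewrite -Ek mulgK.
by apply: ribbon_comp (conj_setV rXY); exact: ribbon_comp rXY hXX.
Qed.

Lemma conj_semidirect :
  semidirect (conj_groupoid iota Delta) (parabolic_groupoid iota Delta)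
    (nu_groupoid nu).
Proof.
split.
- by move=> X _ g [<- Xg]; apply: pargroup_conj.
- by move=> X Y g gXY; apply/ribbon_conj/nu_groupoid_ribbon.
- by move=> X Y g [].
- move=> X Y g gXY; have [p [r [Xp rXY Eg]]] := conj_decomp gXY.
  (* The ribbon [r] need not lie in [nu_groupoid nu]; its own factor [q] in A_X is absorbed by
     [p]. *)
  have [q [f [Xq fXY Er]]] := ribbon_decomp rXY.
  have {}Eg : g = p * q * f by rewrite Eg Er mulgA.
  have Xpq := pargroupM Xp Xq.
  exists (X, (p * q, f)); split=> [//|[_ [q' f']] [/= [<- Xq'] fXY' Eg']].
  by rewrite (nu_decomp_unique Xpq fXY Eg Xq' fXY' Eg').
move=> X Y g gXY.
have := conj_mor_coset (ribbon_conj (nu_groupoid_ribbon gXY)).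
move=> /seteqP[XY YX]; apply/seteqP; split=> _ [h [_ Xh] <-].
  by have [|k Yk <-] := XY (h * g); [exists h | exists k].
by have [|k Yk <-] := YX (g * h); [exists h | exists k].
Qed.

End Nu.

End Fractions.

Theorem theorem4p25 (M : monoidType) (Delta : M)
    (hM : garside_structure Delta)
    (A : groupType) (iota : UMagmaMorphism.type M A)
    (hA : group_of_fractions iota)
    (nu nu' : par iota Delta -> atoms M -> M)
    (hnu : nu_structure nu nu') :
  semidirect (ribbon iota Delta) (qz_groupoid iota Delta) (nu_groupoid nu) /\
  semidirect (conj_groupoid iota Delta) (parabolic_groupoid iota Delta)
    (nu_groupoid nu).
Proof.
split; first exact: ribbon_semidirect hnu.
exact: conj_semidirect hnu.
Qed.
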